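(* Let $G$ be a topological group with identity $e$ and let $T\subseteq G$. (i) If $T$ is right uniformly discrete (respectively, left uniformly discrete), then $T$ is an approximable $\mathcal{LUC}(G)$-interpolation set (respectively, an approximable $\mathcal{RUC}(G)$-interpolation set). (ii) If $G$ is an $E$-group, and $T$ is an $E$-set that is right (respectively, left) $U$-uniformly discrete with respect to some neighbourhood $U$ of $e$, and $VT$ (respectively, $TV$) is translation-compact for some neighbourhood $V$ of $e$ with $V^2\subseteq U$, then $T$ is an approximable $\mathcal{WAP}(G)$-interpolation set.
   Context: $\mathcal{LUC}(G)$ (respectively, $\mathcal{RUC}(G)$) is the algebra of bounded $f:G\to\mathbb C$ such that for every $\epsilon>0$ there is a neighbourhood $N$ of $e$ with $|f(s)-f(t)|<\epsilon$ whenever $st^{-1}\in N$ (respectively, $s^{-1}t\in N$). $\mathcal{WAP}(G)$ is the algebra of weakly almost periodic functions: bounded continuous $f$ whose set of left translates $f_s(t)=f(st)$ is relatively weakly compact in the Banach space of bounded continuous functions on $G$. Let $\mathcal A(G)$ be a set of bounded scalar-valued functions on $G$. $T\subseteq G$ is an $\mathcal A(G)$-interpolation set if every bounded $f:T\to\mathbb C$ extends to a function in $\mathcal A(G)$. It is an approximable $\mathcal A(G)$-interpolation set if, in addition, for every neighbourhood $N$ of $e$ there are open neighbourhoods $V_1,V_2$ of $e$ with $\overline{V_1}\subseteq V_2\subseteq N$ such that for each $T_1\subseteq T$ there is $h\in\mathcal A(G)$ with $h(V_1T_1)\subseteq\{1\}$ and $h(G\setminus V_2T_1)\subseteq\{0\}$.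 $T$ is right (respectively, left) $U$-uniformly discrete if $Us\cap Us'=\emptyset$ (respectively, $sU\cap s'U=\emptyset$) for all $s\ne s'$ in $T$; right (left) uniformly discrete if this holds for some neighbourhood $U$ of $e$. A set $S\subseteq G$ is right translation-compact if every non-relatively compact $L\subseteq G$ contains a finite subset $F$ such that $\bigcap_{b\in F}b^{-1}S$ is relatively compact; left translation-compact if the same holds with $\bigcap_{b\in F}Sb^{-1}$; translation-compact if both. For $G$ non-compact, an $E$-set is a non-relatively compact subset $T$ of $G$ such that for each neighbourhood $N$ of $e$, $\bigcap\{t^{-1}Nt:t\in T\cup T^{-1}\}$ is again a neighbourhood of $e$. $G$ is an $E$-group if it is non-compact and contains an $E$-set.
   Formalization: In the RUC half of (i), ''approximable'' is taken with h(T1V1)={1} and h(G\T1V2)={0} instead of V1T1 and V2T1; the literal version fails in the group (a,b)(c,d)=(ac,ad+b), a>0, with T={(2^n,0)}. *)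

(* Defs.v *)
From HB Require Import structures.
From mathcomp Require Import all_boot all_order all_algebra.
From mathcomp Require Import complex.
From mathcomp Require Import all_classical all_reals all_analysis.

Set Implicit Arguments.
Unset Strict Implicit.
Unset Printing Implicit Defensive.

Import Order.TTheory GRing.Theory Num.Theory.
Import numFieldNormedType.Exports.

Local Open Scope classical_set_scope.
Local Open Scope ring_scope.
Local Open Scope complex_scope.

HB.mixin Record isTopologicalGroup G & Topological G & Group G := {
  mulg_continuous : continuous (fun x : G * G => (x.1 * x.2)%g) ;
  invg_continuous : continuous (fun x : G => (x^-1)%g)
}.

(* No separation axiom is assumed. *)
#[short(type="topologicalGroupType")]
HB.structure Definition TopologicalGroup :=
  {G of Topological G & Group G & isTopologicalGroup G}.

(* [R[i]] itself carries no canonical topology; viewed as an element of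
   [numClosedFieldType] it gets the one induced by the modulus. *)
Definition Cplx (R : realType) : numClosedFieldType := R[i].

Section WeakTopology.
Variables (K : numFieldType) (E : normedModType K).

Definition dual : Type := {phi : {linear E -> K^o} | continuous phi}.

Definition dual_eval (x : E) : {ptws dual -> K} := fun phi => sval phi x.

Definition relatively_weakly_compact (A : set E) : Prop :=
  precompact (A : set (initial_topology dual_eval)).

End WeakTopology.

Section BoundedContinuous.
Variables (R : realType) (G : topologicalType).
Local Notation C := (Cplx R).

Definition bcont : {pred G -> C} :=
  mem [set f : G -> C | continuous f /\ bounded_fun f].

Lemma bcontP (f : G -> C) :
  reflect (continuous f /\ exists M, forall x, `|f x| <= M) (f \in bcont).
Proof.
apply: (iffP idP) => [/set_mem[cf bf]|[cf [M fM]]].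
  by split=> //; have [M fM] := @filter_ex _ (pinfty_nbhs C) _ _ bf; exists M => x; exact: fM.
apply/mem_set; split=> //; exists `|M|; split=> [|N MN x _ /=].
  exact: normr_real.
rewrite (le_trans (fM x))// -(ger0_norm (le_trans (normr_ge0 _) (fM x))).
exact: ltW.
Qed.

Fact bcont_submod_closed : submod_closed bcont.
Proof.
split=> [|a f g /bcontP[cf [M fM]] /bcontP[cg [N gN]]].
  apply/bcontP; split; first by move=> x; exact: cst_continuous.
  by exists 0 => x; rewrite normr0.
apply/bcontP; split.
  move=> x; apply: cvgD (cg x).
  by apply: cvgM (cf x); exact: cvg_cst.
exists (`|a| * M + N) => x; apply: (le_trans (ler_normD _ _)).
by rewrite lerD// normrM ler_wpM2l.
Qed.

HB.instance Definition _ :=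
  GRing.isSubmodClosed.Build C (G -> C) bcont bcont_submod_closed.

Record bcfun := BCFun { bcfun_val :> G -> C ; _ : bcfun_val \in bcont }.

HB.instance Definition _ := [isSub for bcfun_val].
HB.instance Definition _ := [Choice of bcfun by <:].
HB.instance Definition _ := [SubChoice_isSubLmodule of bcfun by <:].

(* The modulus is a real element of the complex field, hence [complex.Re]. *)
Definition sup_norm (f : bcfun) : C :=
  (sup (range (fun x => complex.Re `|f x|)))%:C.

Lemma sup_norm_ub (f : bcfun) x : `|f x| <= sup_norm f.
Proof.
have [_ [M fM]] := bcontP _ (valP f).
rewrite /sup_norm.
have E y : `|f y| = (complex.Re `|f y|)%:C.
  by rewrite RRe_real//; exact: normr_real.
rewrite E lecR; apply: ub_le_sup; last by exists x.
exists (complex.Re M) => _ [y _ <-].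
by have := fM y; rewrite E lecE => /andP[].
Qed.

Lemma sup_norm_le (f : bcfun) (M : C) :
  0 <= M -> (forall x, `|f x| <= M) -> sup_norm f <= M.
Proof.
move=> M0 fM.
have ME : M = (complex.Re M)%:C by rewrite RRe_real//; exact: ger0_real.
rewrite ME /sup_norm lecR.
have [->|/set0P ne] := eqVneq (range (fun x => complex.Re `|f x|)) set0.
  by rewrite sup0; move: M0; rewrite lecE => /andP[].
apply: ge_sup => // _ [y _ <-].
by have := fM y; rewrite lecE => /andP[].
Qed.

Lemma sup_norm_ge0 (f : bcfun) : 0 <= sup_norm f.
Proof.
have [[x _]|G0] := pselect (exists x : G, True).
  by apply: le_trans (sup_norm_ub f x).
rewrite /sup_norm; set A := (X in sup X).
suff -> : A = set0 by rewrite sup0.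
by apply/seteqP; split=> // r [x _ _]; case: G0; exists x.
Qed.

Fact sup_norm_triangle (f g : bcfun) : sup_norm (f + g) <= sup_norm f + sup_norm g.
Proof.
apply: sup_norm_le => [|x]; first by rewrite addr_ge0 ?sup_norm_ge0.
by rewrite (le_trans (ler_normD _ _))// lerD ?sup_norm_ub.
Qed.

Fact sup_normZ (a : C) (f : bcfun) : sup_norm (a *: f) = `|a| * sup_norm f.
Proof.
have le b g : sup_norm (b *: g) <= `|b| * sup_norm g.
  apply: sup_norm_le => [|x]; first by rewrite mulr_ge0 ?sup_norm_ge0.
  by rewrite normrM ler_wpM2l ?sup_norm_ub.
apply/le_anti; rewrite le /=.
have [->|a0] := eqVneq a 0; first by rewrite normr0 mul0r sup_norm_ge0.
rewrite -ler_pdivlMl ?normr_gt0// -normfV.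
by rewrite -[X in sup_norm X](scalerK a0) le.
Qed.

Fact sup_norm_eq0 (f : bcfun) : sup_norm f = 0 -> f = 0.
Proof.
move=> f0; apply/val_inj/funext => x; apply/eqP.
by rewrite -normr_le0 -f0 sup_norm_ub.
Qed.

HB.instance Definition _ := Lmodule_isNormed.Build C bcfun
  sup_norm_triangle sup_normZ sup_norm_eq0.

End BoundedContinuous.

Section Sets.
Variable G : topologicalGroupType.

Definition setmulg (A B : set G) : set G :=
  [set (a * b)%g | a in A & b in B].

Definition right_discrete_wrt (U T : set G) : Prop :=
  forall s t, T s -> T t -> s <> t ->
    setmulg U [set s] `&` setmulg U [set t] = set0.

Definition left_discrete_wrt (U T : set G) : Prop :=
  forall s t, T s -> T t -> s <> t ->
    setmulg [set s] U `&` setmulg [set t] U = set0.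

Definition right_uniformly_discrete (T : set G) : Prop :=
  exists2 U, nbhs 1%g U & right_discrete_wrt U T.

Definition left_uniformly_discrete (T : set G) : Prop :=
  exists2 U, nbhs 1%g U & left_discrete_wrt U T.

(* Relative compactness is [precompact], i.e. compactness of the closure. *)
Definition right_translation_compact (S : set G) : Prop :=
  forall L : set G, ~ precompact L ->
    exists F : set G, [/\ finite_set F, F `<=` L &
      precompact (\bigcap_(b in F) setmulg [set b^-1%g] S)].

Definition left_translation_compact (S : set G) : Prop :=
  forall L : set G, ~ precompact L ->
    exists F : set G, [/\ finite_set F, F `<=` L &
      precompact (\bigcap_(b in F) setmulg S [set b^-1%g])].

Definition translation_compact (S : set G) : Prop :=
  right_translation_compact S /\ left_translation_compact S.

Definition E_set (T : set G) : Prop :=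
  ~ precompact T /\
  forall N, nbhs 1%g N ->
    nbhs 1%g (\bigcap_(t in T `|` [set s^-1%g | s in T])
              [set (t^-1 * x * t)%g | x in N]).

Definition E_group : Prop := ~ compact [set: G] /\ exists T : set G, E_set T.

End Sets.

Section FunctionAlgebras.
Variables (R : realType) (G : topologicalGroupType).
Local Notation C := (Cplx R).

Definition LUC : set (G -> C) := [set f | bounded_fun f /\
  forall eps : R, 0 < eps -> exists2 N : set G, nbhs 1%g N &
    forall s t, N (s * t^-1)%g -> `|f s - f t| < eps%:C].

Definition RUC : set (G -> C) := [set f | bounded_fun f /\
  forall eps : R, 0 < eps -> exists2 N : set G, nbhs 1%g N &
    forall s t, N (s^-1 * t)%g -> `|f s - f t| < eps%:C].

Definition left_translates (f : G -> C) : set (G -> C) :=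
  [set h | exists s, h = fun t => f (s * t)%g].

Definition WAP : set (G -> C) := [set f |
  [/\ continuous f, bounded_fun f &
      relatively_weakly_compact
        [set h : bcfun R G | left_translates f (bcfun_val h)]]].

Definition interpolation_set (A : set (G -> C)) (T : set G) : Prop :=
  forall f : G -> C, [bounded f t | t in T] ->
    exists2 g, A g & forall t, T t -> g t = f t.

(* [nb V T] is [V T] for the standard notion and [T V] for its mirror image. *)
Definition approximable_interpolation_set_for
    (nb : set G -> set G -> set G) (A : set (G -> C)) (T : set G) : Prop :=
  interpolation_set A T /\
  forall N : set G, nbhs 1%g N -> exists V1 V2 : set G,
    [/\ open_nbhs 1%g V1, open_nbhs 1%g V2, closure V1 `<=` V2, V2 `<=` N &
      forall T1 : set G, T1 `<=` T -> exists2 h, A h &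
        (forall x, nb V1 T1 x -> h x = 1) /\
        (forall x, ~ nb V2 T1 x -> h x = 0)].

Definition approximable_interpolation_set :=
  approximable_interpolation_set_for (fun V T => setmulg V T).

(* [RUC] is the image of [LUC] under [f |-> f \o invg], which turns [V T] into
   [T V]; the notion going with [RUC] and left uniform discreteness is therefore
   the mirror one. With [V T], left uniformly discrete sets need not be
   approximable for [RUC]: in the group of pairs [(a, b)], [a > 0], with
   [(a, b) (c, d) = (a c, a d + b)], take for [T] the points [t_n = (2 ^ n, 0)]
   and for [N] the set [1/2 < a < 2, |b| < 1]. If [h] is 1 on [T] and 0 off
   [V2 T] with [V2] included in [N], then [h (t_n (1, d)) = h (2 ^ n, 2 ^ n d)]
   is 0 as soon as [2 ^ n |d| >= 1], so [h] is not in [RUC]. *)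
Definition mirror_approximable_interpolation_set :=
  approximable_interpolation_set_for (fun V T => setmulg T V).

End FunctionAlgebras.

Arguments LUC : clear implicits.
Arguments RUC : clear implicits.
Arguments WAP : clear implicits.

(* Main.v *)
(** Let [l] be a truncated length function on [G] whose unit ball lies in a small
neighbourhood of the identity. Such an [l] is uniformly continuous on both
sides, so bumps [b (l (x t^-1))] placed around the points [t] of a right
uniformly discrete set, with arbitrary bounded weights, add up to a function in
LUC; inversion gives RUC. On an E-set the sum is moreover in RUC.

If the sum [f] is supported in a translation-compact set, consider an ultrafilter
on [G]. When it contains a precompact set, the left translates of [f] converge
in norm along it. Otherwise they converge to some [g] uniformly on precompact
sets, and [g] has precompact support. If some functional did not tend to [0] on
the differences, Ptak's combinatorial lemma would give translates by a sequence
with no precompact subsequence, any finitely many of them having supports that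
meet outside the support of [g]; this contradicts translation compactness. Hence
the set of left translates is relatively weakly compact. *)
Require Import Defs.
From mathcomp Require Import all_boot all_order all_algebra.
From mathcomp Require Import complex finmap.
From mathcomp Require Import all_classical all_reals all_analysis.
From mathcomp Require Import ring lra zify.

Set Implicit Arguments.
Unset Strict Implicit.
Unset Printing Implicit Defensive.

Import Order.TTheory GRing.Theory Num.Theory.
Import numFieldNormedType.Exports.

Local Open Scope classical_set_scope.
Local Open Scope ring_scope.
Local Open Scope complex_scope.

(** * Ptak's lemma *)

Section ConvexChains.
Variables (R : realType) (X : Type) (E : nat -> set X).

(** The model for [D k] is the set of finite convex combinations of the indicators of the [E n] with
    [k <= n]. The coefficients are forgotten; only supports remember which indices occur. *)
Record convex_chain (D : nat -> set (X -> R)) : Prop := ConvexChain {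
  chain_nonempty : forall k, D k !=set0 ;
  chain_decr : forall k, D k.+1 `<=` D k ;
  chain_convex : forall k u v (a : R), 0 <= a <= 1 -> D k u -> D k v ->
    D k (fun x => a * u x + (1 - a) * v x) ;
  chain_range : forall k u x, D k u -> 0 <= u x <= 1 ;
  chain_support : forall k u, D k u -> exists N, forall x, u x != 0 ->
    exists2 n, (k <= n < N)%N & E n x }.

Lemma chain_le D k l : convex_chain D -> (k <= l)%N -> D l `<=` D k.
Proof.
move=> cD; elim: l => [|l IH]; first by rewrite leqn0 => /eqP ->.
rewrite leq_eqVlt ltnS => /predU1P[-> //|/IH DlDk].
exact: subset_trans (chain_decr cD (k := l)) DlDk.
Qed.

Definition bounded_below_on (Y : set X) (D : nat -> set (X -> R)) : Prop :=
  exists2 e : R, 0 < e & forall u, D 0%N u -> exists2 x, Y x & e <= u x.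

Section Step.
Variables (Y : set X) (D : nat -> set (X -> R)) (m : nat).
Hypothesis cD : convex_chain D.
Hypothesis small : forall n, (m <= n)%N -> forall D', convex_chain D' ->
  ~ bounded_below_on (Y `&` E n) D'.

Lemma small_elt n D' e : (m <= n)%N -> convex_chain D' -> 0 < e ->
  exists2 u, D' 0%N u & forall x, Y x -> E n x -> u x < e.
Proof.
move=> mn cD' e0; apply: contrapT => H; apply: (small mn cD'); exists e => // u Du.
apply: contrapT => H'; apply: H; exists u => // x Yx Ex.
by rewrite ltNge; apply/negP => le; apply: H'; exists x.
Qed.

(** Induction on [N]: the elements already small on the earlier sets form a chain, so [small]
    applies to each of its tails and gives, at any rank, an element small on one more set. *)
Lemma small_subchain (d : R) N : 0 < d -> convex_chain (fun k =>
  [set u | D (m + k)%N u /\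
    forall n x, (m <= n < N)%N -> Y x -> E n x -> u x < d]).
Proof.
move=> d0; elim: N => [|N IH].
all: split => [k|k u [Du su]|k u v a a01 [Du su] [Dv sv]|k u x [Du su]|k u [Du su]].
all: try by split=> //; move: Du; rewrite addnS; apply: chain_decr.
all: try exact: chain_range Du.
all: try by have [N' HN'] := chain_support cD Du;
  exists N' => x /HN'[n /andP[kn nN] En]; exists n => //; lia.
- by have [u Du] := chain_nonempty cD (m + k)%N; exists u; split => // n x; rewrite ltn0 andbF.
- by split=> [|n x]; [exact: chain_convex|rewrite ltn0 andbF].
- have [Nm|mN] := ltnP N m.
    have [u [Du su]] := chain_nonempty IH k.
    by exists u; split => // n x ?; apply: su; lia.
  have IHk : convex_chain (fun j => [set u | D (m + (k + j))%N u /\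
      forall n x, (m <= n < N)%N -> Y x -> E n x -> u x < d]).
    split=> [j|j u|j u v a|j u x|j u Du].
    + exact: (chain_nonempty IH).
    + by rewrite addnS; apply: (chain_decr IH).
    + exact: (chain_convex IH).
    + exact: (chain_range IH).
    + have [N' HN'] := chain_support IH Du.
      by exists N' => x /HN'[n ? ?]; exists n => //; lia.
  have [u /= [Du su] sN] := small_elt mN IHk d0.
  exists u; rewrite addn0 in Du; split => // n x /andP[mn].
  by rewrite ltnS leq_eqVlt => /predU1P[-> | nN]; [exact: sN|apply: su; rewrite mn].
- split; first exact: chain_convex.
  move=> n x mnN Yx Ex; have := su _ _ mnN Yx Ex; have := sv _ _ mnN Yx Ex.
  move: a01 => /andP[]; rewrite le_eqVlt => /predU1P[<- _|a0 a1].
    by rewrite mul0r add0r subr0 mul1r.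
  by nra.
Qed.

(* Averaging elements whose successive supports are nearly disjoint: each new
   element is at most [d] where an earlier one is non-zero. *)
Lemma small_average (d : R) p : 0 < d ->
  exists2 u, D m u & forall x, Y x -> u x <= p.+1%:R^-1 + d.
Proof.
move=> d0; elim: p => [|p [u Du su]].
  have [u Du] := chain_nonempty cD m; exists u => // x _.
  by have /andP[_ u1] := chain_range cD x Du; rewrite invr1; lra.
have [N HN] := chain_support cD Du.
have [v [Dv sv]] := chain_nonempty (small_subchain N d0) 0%N.
rewrite addn0 in Dv.
have p0 : (0 : R) < p.+1%:R by rewrite ltr0n.
have p1 : (p.+2%:R : R) = p.+1%:R + 1 by rewrite [in LHS]mulrSr.
set q : R := p.+1%:R in p0 p1 su *.
(* With these coefficients, [1 / q + d] for [u] and [d] for [v] average to [1 / (q + 1) + d]; where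
   [u] vanishes, [v x <= 1] alone gives [1 / (q + 1)]. *)
exists (fun x => (q / (q + 1)) * u x + (1 - q / (q + 1)) * v x).
  apply: chain_convex => //; apply/andP; split; first by rewrite divr_ge0//; lra.
  by rewrite ler_pdivrMr; lra.
move=> x Yx; rewrite p1.
have -> : 1 - q / (q + 1) = (q + 1)^-1 by field; rewrite lt0r_neq0//; lra.
rewrite -[X in X + d]div1r -mulrA [_^-1 * u x]mulrC mulrA [_^-1 * v x]mulrC -mulrDl.
rewrite ler_pdivrMr; last lra.
rewrite mulrDl divfK; last by rewrite lt0r_neq0//; lra.
have /andP[v0 v1] := chain_range cD x Dv.
have [ux0|/HN[n mnN Ex]] := eqVneq (u x) 0; first by rewrite ux0; nra.
have := sv _ _ mnN Yx Ex; have := su x Yx.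
have : q * q^-1 = 1 by rewrite divff// lt0r_neq0.
by move: (q^-1) => r; nra.
Qed.

Lemma not_bounded_below_on : ~ bounded_below_on Y D.
Proof.
move=> [e e0 De].
have e20 : 0 < e / 2 by lra.
have [p _ /(_ p (leqnn p)) hp] := near_infty_natSinv_lt (PosNum e20).
have [u Du su] := small_average p e20.
have [x Yx] := De u (chain_le cD (leq0n m) Du).
have := su x Yx; move: hp; move=> /=; move: (p.+1%:R^-1) => r; lra.
Qed.

End Step.

(** Ptak's lemma. If it fails, [not_bounded_below_on] allows one to intersect with a further [E n]
    again and again, keeping a chain bounded below on the intersection, which is then never empty.
    The chain may change at each stage. *)
Lemma chain_uniformly_small D (e : R) : convex_chain D ->
  (forall s : nat -> nat, {homo s : i j / (i < j)%N} ->
    exists k, \bigcap_(i in `I_k) E (s i) = set0) ->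
  0 < e -> exists2 u, D 0%N u & forall x, u x < e.
Proof.
move=> cD noseq e0; apply: contrapT => nsmall.
pose good (z : set X * nat) := exists2 D', convex_chain D' & bounded_below_on z.1 D'.
have good0 : good (setT, 0%N).
  exists D => //; exists e => // u Du; apply: contrapT => H; apply: nsmall.
  by exists u => // x; rewrite ltNge; apply/negP => ?; apply: H; exists x.
have step (z : {z | good z}) : exists z' : {z | good z},
    exists2 n, (sval z).2 = n & exists2 n', (n <= n')%N &
      sval z' = ((sval z).1 `&` E n', n'.+1).
  case: z => -[Y m] [/= D' cD' bD'] /=; apply: contrapT => H.
  apply: (@not_bounded_below_on Y D' m cD') => // n mn D'' cD'' bD''; apply: H.
  have g : good (Y `&` E n, n.+1) by exists D''.
  by exists (exist _ _ g); exists m => //; exists n.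
have [f Hf] := choice step.
pose z n := iter n f (exist _ _ good0).
(* The rank stored after choosing [n'] is [n'.+1], which forces the next index to be larger; the
   predecessor recovers [n']. *)
pose s n := (sval (z n.+1)).2.-1.
have zS n : ((sval (z n)).2 <= s n)%N /\
    sval (z n.+1) = ((sval (z n)).1 `&` E (s n), (s n).+1).
  by rewrite /s /=; have [_ <- [n' le ->]] := Hf (z n).
have smono : {homo s : i j / (i < j)%N}.
  apply: homo_ltn => [j i k ij jk|i]; first exact: ltn_trans ij jk.
  by have [le _] := zS i.+1; have [_ E1] := zS i; move: le; rewrite E1.
have [k sk] := noseq s smono.
have zE n : (sval (z n)).1 = \bigcap_(i in `I_n) E (s i).
  elim: n => [|n IH]; first by rewrite /= II0 bigcap_set0.
  by have [_ ->] := zS n; rewrite /= IH IIS bigcap_setU bigcap_set1.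
have [D' cD' [d d0 D'd]] := svalP (z k); rewrite zE sk in D'd.
have [u Du] := chain_nonempty cD' 0%N.
by have [x []] := D'd u Du.
Qed.

End ConvexChains.

(** * Length functions *)

Section TopologicalGroupFacts.
Variable G : topologicalGroupType.
Implicit Types (x y : G) (A N U V : set G).

Lemma continuousM (f g : G -> G) :
  continuous f -> continuous g -> continuous (fun x => f x * g x)%g.
Proof.
move=> cf cg x.
apply: (@continuous2_cvg _ _ _ _ _ _ f g (fun a b => (a * b)%g) _ _ _ (cf x) (cg x)).
exact: (@mulg_continuous G (f x, g x)).
Qed.

Lemma continuous_cstg (a : G) : continuous (fun _ : G => a).
Proof. by move=> x; exact: cvg_cst. Qed.

Lemma continuous_idg : continuous (fun x : G => x).
Proof. by move=> x. Qed.

Lemma continuous_Ml (a : G) : continuous (fun x => a * x)%g.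
Proof. exact: continuousM (@continuous_cstg a) continuous_idg. Qed.

Lemma continuous_Mr (a : G) : continuous (fun x => x * a)%g.
Proof. exact: continuousM continuous_idg (@continuous_cstg a). Qed.

Lemma nbhs1_divr N x : nbhs 1%g N -> nbhs x [set y | N (y * x^-1)%g].
Proof. by move=> N1; apply: (@continuous_Mr x^-1%g x); rewrite mulgV. Qed.

Lemma nbhs1_divl N x : nbhs 1%g N -> nbhs x [set y | N (x^-1 * y)%g].
Proof. by move=> N1; apply: (@continuous_Ml x^-1%g x); rewrite mulVg. Qed.

Lemma nbhs1_inv N : nbhs 1%g N -> nbhs 1%g [set x | N x^-1%g].
Proof. by move=> N1; apply: (@invg_continuous G 1%g); rewrite invg1. Qed.

Lemma nbhs1_square N : nbhs 1%g N ->
  exists2 M, nbhs 1%g M & forall x y, M x -> M y -> N (x * y)%g.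
Proof.
move=> N1.
have : nbhs (1%g, 1%g) [set p : G * G | N (p.1 * p.2)%g].
  by apply: (@mulg_continuous G (1%g, 1%g)); rewrite /= mulg1.
case=> -[A B] /= [A1 B1] AB; exists (A `&` B); first exact: filterI.
by move=> x y [Ax _] [_ By]; exact: (AB (x, y)).
Qed.

Lemma nbhs1_cube N : nbhs 1%g N -> exists2 M, nbhs 1%g M &
  forall x y z, M x -> M y -> M z -> N (x * y * z)%g.
Proof.
move=> /nbhs1_square[M1 /nbhs1_square[M2 M21 M2M] M1M].
exists M2 => // x y z Mx My Mz; apply: M1M; first exact: M2M.
by rewrite -(mulg1 z); apply: M2M => //; exact: nbhs_singleton.
Qed.

End TopologicalGroupFacts.

Record length_function (R : realType) (G : topologicalGroupType) (l : G -> R) :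
    Prop := LengthFunction {
  len_ge0 : forall x, 0 <= l x ;
  len1 : l 1%g = 0 ;
  lenM : forall x y, l (x * y)%g <= l x + l y ;
  len_small : forall e : R, 0 < e -> nbhs 1%g [set x | l x < e] }.

Section LengthFunctions.
Variables (R : realType) (G : topologicalGroupType).

Section Chain.
Variable V : nat -> set G.
Hypothesis V1 : forall n, nbhs 1%g (V n).
Hypothesis V3 : forall n x y z,
  V n.+1 x -> V n.+1 y -> V n.+1 z -> V n (x * y * z)%g.

Implicit Type s : seq (nat * G).

(** A letter [(n, x)] of an admissible word is an element [x] of [V n], at cost [2^-n], as in the
    Birkhoff-Kakutani construction. *)
Definition word s : G := (\prod_(p <- s) p.2)%g.
Definition weight s : R := \sum_(p <- s) 2^-1 ^+ p.1.
Definition admissible s := {in s, forall p, V p.1 p.2}.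

Let pow_gt0 n : 0 < 2^-1 ^+ n :> R. Proof. by rewrite exprn_gt0. Qed.

Lemma weight_ge0 s : 0 <= weight s.
Proof. by apply: sumr_ge0 => p _; exact: ltW. Qed.

Lemma chain_unit n : V n 1%g. Proof. exact: nbhs_singleton. Qed.

Lemma chain_sub m n : (m <= n)%N -> V n `<=` V m.
Proof.
elim: n => [|n IH]; first by rewrite leqn0 => /eqP ->.
rewrite leq_eqVlt ltnS => /predU1P[-> //|/IH h] x Vx; apply: h.
by rewrite -[x]mulg1 -[x]mulg1; apply: V3 => //; exact: chain_unit.
Qed.

Lemma weight_split (c : R) s : 0 < c -> c <= weight s ->
  exists s1 p s2, [/\ s = s1 ++ p :: s2, weight s1 < c &
    c <= weight s1 + 2^-1 ^+ p.1].
Proof.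
elim: s c => [|p s IH] c c0; first by rewrite /weight big_nil; lra.
rewrite /weight big_cons -/(weight s) => cs.
have [cp|pc] := lerP c (2^-1 ^+ p.1).
  by exists [::], p, s; split => //; rewrite /weight big_nil// add0r.
have [||s1 [q [s2 [-> s1c cs1]]]] := IH (c - 2^-1 ^+ p.1); [lra|lra|].
exists (p :: s1), q, s2; rewrite /weight big_cons -/(weight s1).
by split=> //; lra.
Qed.

Lemma admissible_cat s1 s2 : admissible (s1 ++ s2) <-> admissible s1 /\ admissible s2.
Proof.
split=> [ad|[ad1 ad2] p]; last by rewrite mem_cat => /orP[/ad1|/ad2].
by split=> p ps; apply: ad; rewrite mem_cat ps ?orbT.
Qed.

(* Cut the word where the weight reaches half of the bound. *)
Lemma word_in_chain s m : admissible s -> weight s < 2^-1 ^+ m -> V m (word s).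
Proof.
have [k] := ubnP (size s); elim: k s m => // k IH s m sk ad sm.
have half : 2^-1 ^+ m = 2^-1 ^+ m.+1 + 2^-1 ^+ m.+1 :> R.
  by rewrite exprS; move: (2^-1 ^+ m) => r; lra.
have exp_ltP n : (2^-1 ^+ n < 2^-1 ^+ m :> R) -> (m < n)%N.
  by rewrite ltr_iXn2l//; lra.
case: s => [|q s] in sk ad sm *; first by rewrite /word big_nil; exact: chain_unit.
have [s1 [p [s2 [E s1m ps1]]]] : exists s1 p s2, [/\ q :: s = s1 ++ p :: s2,
    weight s1 < 2^-1 ^+ m.+1 & weight s2 < 2^-1 ^+ m.+1].
  have [le|lt] := lerP (2^-1 ^+ m.+1) (weight (q :: s)).
    have [s1 [p [s2 [E s1m ps1]]]] := weight_split (pow_gt0 _) le.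
    exists s1, p, s2; split=> //; move: sm.
    by rewrite E /weight big_cat big_cons -/(weight s1) -/(weight s2) /= half; lra.
  exists [::], q, s; split=> //; first by rewrite /weight big_nil.
  by apply: le_lt_trans lt; rewrite [leRHS]/weight big_cons lerDr ltW.
have szE := congr1 size E; rewrite E in ad sm *; move: szE.
rewrite size_cat /= => szE.
have /admissible_cat[ad1] := ad; rewrite -cat1s => /admissible_cat[adp ad2].
(* A single letter of weight below [2^-m] has index at least [m.+1]. *)
have Vp : V m.+1 p.2.
  apply: (@chain_sub _ p.1); last by apply: adp; rewrite mem_head.
  apply: exp_ltP; apply: le_lt_trans sm.
  rewrite /weight big_cat big_cons -/(weight s1) -/(weight s2) /=.
  by have := weight_ge0 s1; have := weight_ge0 s2; lra.
rewrite /word big_cat big_cons /= mulgA.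
by apply: V3 => //; apply: IH => //; move: sk => /=; lia.
Qed.

(** The extra weight 1 truncates the length and keeps the set non-empty when [x] is not an
    admissible product. *)
Definition word_weights (x : G) : set R :=
  [set 1] `|` [set weight s | s in [set s | admissible s /\ word s = x]].

Definition chain_length (x : G) : R := inf (word_weights x).

Lemma word_weights_ge0 x : lbound (word_weights x) 0.
Proof. by move=> _ [->|[s _ <-]]; [exact: ler01|exact: weight_ge0]. Qed.

Lemma word_weights_ne x : word_weights x !=set0.
Proof. by exists 1; left. Qed.

Lemma chain_length_le x r : word_weights x r -> chain_length x <= r.
Proof. by apply: ge_inf; exists 0; exact: word_weights_ge0. Qed.

(** Subadditivity comes from concatenating words, and smallness near the identity from one-letter
    words. *)
Lemma chain_length_fun : length_function chain_length.
Proof.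
split=> [x||x y|e e0].
- by apply: lb_le_inf; [exact: word_weights_ne|exact: word_weights_ge0].
- apply/eqP; rewrite eq_le; apply/andP; split; last first.
    by apply: lb_le_inf; [exact: word_weights_ne|exact: word_weights_ge0].
  apply: chain_length_le; right; exists [::]; last by rewrite /weight big_nil.
  by split=> //; rewrite /word big_nil.
- rewrite -lerBlDr; apply: lb_le_inf; first exact: word_weights_ne.
  move=> r xr; rewrite lerBlDl -lerBlDr; apply: lb_le_inf; first exact: word_weights_ne.
  move=> r' yr'; rewrite lerBlDl.
  have r0 := word_weights_ge0 xr; have r'0 := word_weights_ge0 yr'.
  have big1 : 1 <= r + r' -> chain_length (x * y)%g <= r + r'.
    by apply: le_trans; apply: chain_length_le; left.
  case: xr yr' => [->|[s [ads <-] <-]] [->|[t [adt <-] <-]] in r0 r'0 big1 *.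
  + by apply: big1; lra.
  + by apply: big1; lra.
  + by apply: big1; lra.
  apply: chain_length_le; right; exists (s ++ t); last by rewrite /weight big_cat.
  by split; [exact/admissible_cat|rewrite /word big_cat].
- have [n _ /(_ n (leqnn n)) hn] := near_infty_natSinv_expn_lt (PosNum e0).
  have {}hn : 2^-1 ^+ n < e by move: hn; rewrite /= div1r exprVn.
  apply: filterS (V1 n) => x Vx /=; apply: le_lt_trans hn.
  apply: chain_length_le; right; exists [:: (n, x)].
    by split; [move=> p; rewrite inE => /eqP ->|rewrite /word big_seq1].
  by rewrite /weight big_seq1.
Qed.

Lemma chain_length_lt1 x : chain_length x < 1 -> V 0%N x.
Proof.
move=> /(inf_lt (word_weights_ne x))[_ [->|[s [ad <-] <-]]]; first by rewrite ltxx.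
by move=> lt1; apply: word_in_chain.
Qed.

End Chain.

(** Birkhoff-Kakutani along a single chain of neighbourhoods starting at [W], obtained by iterating
    [nbhs1_cube]. *)
Lemma exists_length_function (W : set G) : nbhs 1%g W ->
  exists2 l : G -> R, length_function l & forall x, l x < 1 -> W x.
Proof.
move=> W1.
have step (N : {N : set G | nbhs 1%g N}) : exists M : {M : set G | nbhs 1%g M},
    forall x y z, sval M x -> sval M y -> sval M z -> sval N (x * y * z)%g.
  by have [M M1 MN] := nbhs1_cube (svalP N); exists (exist _ M M1).
have [f Hf] := choice step.
pose V n := sval (iter n f (exist _ W W1)).
have V1 n : nbhs 1%g (V n) by exact: svalP.
have V3 n x y z : V n.+1 x -> V n.+1 y -> V n.+1 z -> V n (x * y * z)%g.
  exact: Hf.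
by exists (chain_length V); [exact: chain_length_fun|exact: chain_length_lt1].
Qed.

Variable l : G -> R.
Hypothesis lenl : length_function l.

(** Subadditivity for [n x] and for [n^-1 (n x)] bounds the change in both directions; as [l] may be
    asymmetric, both [n] and [n^-1] are taken short. *)
Lemma len_near (e : R) : 0 < e -> nbhs 1%g [set n : G | forall x : G,
  `|l (n * x)%g - l x| <= e /\ `|l (x * n)%g - l x| <= e].
Proof.
move=> e0; have small := len_small lenl e0.
apply: filterS (filterI small (nbhs1_inv small)) => n /= [ln lVn] x.
have := lenM lenl n x; have := lenM lenl x n.
have := lenM lenl n^-1%g (n * x)%g; have := lenM lenl (x * n)%g n^-1%g.
by rewrite mulKg mulgK => *; rewrite !ler_norml; split; apply/andP; split; lra.
Qed.

Lemma len_continuous : continuous l.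
Proof.
move=> x; apply/cvgrPdist_le => e e0; apply: filterS (nbhs1_divr x (len_near e0)).
by move=> y /(_ x)[]; rewrite mulgVK distrC.
Qed.

End LengthFunctions.

(** * Functions carried by a uniformly discrete set *)

Section Modulus.
Variable R : realType.
Implicit Types z w : Cplx R.

Definition cmod (z : Cplx R) : R := complex.Re `|z|.

Lemma norm_cmod z : `|z| = (cmod z)%:C :> Cplx R. Proof. by []. Qed.

Lemma cmod_ge0 z : 0 <= cmod z.
Proof. by rewrite -ler0c; exact: (normr_ge0 z). Qed.

Lemma cmod0 : cmod 0 = 0. Proof. by rewrite /cmod normr0. Qed.

Lemma cmodD z w : cmod (z + w) <= cmod z + cmod w.
Proof. by rewrite -lecR rmorphD/=; exact: (ler_normD z w). Qed.

Lemma cmodN z : cmod (- z) = cmod z.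
Proof. by rewrite /cmod normrN. Qed.

Lemma cmod_distC z w : cmod (z - w) = cmod (w - z).
Proof. by rewrite -cmodN opprB. Qed.

Lemma cmod_triangle u z w : cmod (z - w) <= cmod (z - u) + cmod (u - w).
Proof. by rewrite -[z - w](subrKA u); exact: cmodD. Qed.

Lemma cmodM z w : cmod (z * w) = cmod z * cmod w.
Proof.
by apply: complexI; rewrite rmorphM/=; exact: (normrM z w).
Qed.

Lemma cmod_real (x : R) : cmod x%:C = `|x|.
Proof. by rewrite /cmod normc_def /= expr0n addr0 sqrtr_sqr. Qed.

Lemma cmod_eq0 z : cmod z = 0 -> z = 0.
Proof. by move=> z0; apply/eqP; rewrite -normr_eq0 norm_cmod z0. Qed.

Lemma bounded_cmod (T : Type) (f : T -> Cplx R) (A : set T) :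
  [bounded f x | x in A] <-> exists M : R, forall x, A x -> cmod (f x) <= M.
Proof.
split=> [bf|[M fM]].
  have [M fM] := @filter_ex _ (pinfty_nbhs (Cplx R)) _ _ bf.
  by exists (complex.Re M) => x /fM /=; rewrite norm_cmod lecE => /andP[].
exists (`|M|%:C); split=> [|N MN x Ax].
  by apply/complex_realP; exists `|M|.
rewrite /= (le_trans _ (ltW MN))// norm_cmod lecR.
by apply: le_trans (ler_norm _); exact: fM.
Qed.

End Modulus.

Section Spreading.
Variables (R : realType) (G : topologicalGroupType).
Local Notation C := (Cplx R).

(** The thresholds 1/3 and 2/3 become the radii of [V1] and [V2]; both stay below 1, the radius at
    which [l] controls [W]. *)
Definition bump (l : G -> R) (x : G) : R := Num.min 1 (Num.max 0 (2 - 3 * l x)).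

Lemma bump1 (l : G -> R) x : l x <= 1 / 3 -> bump l x = 1.
Proof. by move=> lx; rewrite /bump min_l// le_max; apply/orP; right; lra. Qed.

Lemma bump0 (l : G -> R) x : 2 / 3 <= l x -> bump l x = 0.
Proof. by move=> lx; rewrite /bump max_l ?min_r//; lra. Qed.

Lemma bump_itv (l : G -> R) x : 0 <= bump l x <= 1.
Proof. by rewrite /bump le_min ler01 le_max lexx /= ge_min lexx. Qed.

Lemma bump_lip (l : G -> R) x y : `|bump l x - bump l y| <= 3 * `|l x - l y|.
Proof.
rewrite /bump; move: (l x) (l y) => a b.
by case: (lerP a b) => ab;
  rewrite ler_norml; apply/andP; split;
  rewrite !minElt !maxElt; repeat case: ifPn; rewrite -?leNgt; lra.
Qed.

(* When [T] is right [U]-uniformly discrete this is the function with value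
   [f t * bump l (x t^-1)] at the points [x] of [U t]. *)
Definition spread (U T : set G) (l : G -> R) (f : G -> C) (x : G) : C :=
  let t := xget 1%g [set t | T t /\ U (x * t^-1)%g] in
  if `[< T t /\ U (x * t^-1)%g >] then f t * (bump l (x * t^-1)%g)%:C else 0.

Lemma right_discrete_inj (U T : set G) x s t : right_discrete_wrt U T ->
  T s -> T t -> U (x * s^-1)%g -> U (x * t^-1)%g -> s = t.
Proof.
move=> dT Ts Tt Us Ut; apply: contrapT => st.
have : (setmulg U [set s] `&` setmulg U [set t]) x.
  split; [exists (x * s^-1)%g => //; exists s => //|exists (x * t^-1)%g => //; exists t => //];
  by rewrite mulgVK.
by rewrite dT.
Qed.

Variables (U W T : set G) (l : G -> R) (f : G -> C) (B : R).
Hypothesis dT : right_discrete_wrt U T.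
Hypothesis WU : forall a b, W a -> W b -> U (a * b)%g.
Hypothesis W1 : nbhs 1%g W.
Hypothesis lenl : length_function l.
Hypothesis lW : forall x, l x < 1 -> W x.
Hypothesis fB : forall t, T t -> cmod (f t) <= B.

Let F := spread U T l f.

Lemma disc_sub : W `<=` U.
Proof.
by move=> x Wx; rewrite -[x]mulg1; apply: WU => //; exact: nbhs_singleton.
Qed.

Lemma spreadE x t : T t -> U (x * t^-1)%g -> F x = f t * (bump l (x * t^-1)%g)%:C.
Proof.
move=> Tt Ut; rewrite /F /spread; case: xgetP => [s _ [Ts Us]|/(_ t)[]//].
by rewrite asboolT// (right_discrete_inj dT Ts Tt Us Ut).
Qed.

Lemma spread_neq0 x : F x <> 0 ->
  exists t, [/\ T t, f t <> 0, l (x * t^-1)%g < 2 / 3 & W (x * t^-1)%g].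
Proof.
rewrite /F /spread; set t := xget _ _; case: asboolP => // -[Tt Ut] Fx.
exists t; have lx : l (x * t^-1)%g < 2 / 3.
  by rewrite ltNge; apply/negP => /bump0 b0; apply: Fx; rewrite b0 mulr0.
split=> //; last by apply: lW; lra.
by move=> ft; apply: Fx; rewrite ft mul0r.
Qed.

Lemma spread_bound x : cmod (F x) <= `|B|.
Proof.
have [->|/eqP/spread_neq0[t [Tt _ _ Wx]]] := eqVneq (F x) 0; first by rewrite cmod0.
rewrite (spreadE Tt (disc_sub Wx)) cmodM cmod_real.
have /andP[b0 b1] := bump_itv l (x * t^-1)%g; rewrite (ger0_norm b0).
have := fB Tt; have := ler_norm B; have := cmod_ge0 (f t).
by nra.
Qed.

(** Unless both values vanish, one of the points lies in some [W t], hence the other in [U t]: the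
    same [t] governs both values, and the Lipschitz bound on [bump] applies. *)
Lemma spread_dist x y (e : R) : 0 <= e ->
  (forall t, T t -> W (x * t^-1)%g -> U (y * t^-1)%g) ->
  (forall t, T t -> W (y * t^-1)%g -> U (x * t^-1)%g) ->
  (forall t, T t -> `|l (x * t^-1)%g - l (y * t^-1)%g| <= e) ->
  cmod (F x - F y) <= `|B| * (3 * e).
Proof.
move=> e0 xy yx le.
have key t : T t -> U (x * t^-1)%g -> U (y * t^-1)%g ->
    cmod (F x - F y) <= `|B| * (3 * e).
  move=> Tt Ux Uy; rewrite (spreadE Tt Ux) (spreadE Tt Uy) -mulrBr -rmorphB.
  rewrite cmodM cmod_real; apply: ler_pM; [exact: cmod_ge0|exact: normr_ge0| |].
    exact: le_trans (fB Tt) (ler_norm _).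
  by apply: le_trans (bump_lip _ _ _) _; rewrite ler_pM2l// le.
have [Fx|/eqP/spread_neq0[t [Tt _ _ Wx]]] := eqVneq (F x) 0; last first.
  by apply: (key t) => //; [exact: disc_sub|exact: xy].
have [Fy|/eqP/spread_neq0[t [Tt _ _ Wy]]] := eqVneq (F y) 0; last first.
  by apply: (key t) => //; [exact: yx|exact: disc_sub].
by rewrite Fx Fy subr0 cmod0; rewrite mulr_ge0// mulr_ge0.
Qed.

Lemma small_factor (e : R) : 0 < e -> exists2 d : R, 0 < d & `|B| * (3 * d) < e.
Proof.
move=> e0; exists (e / (3 * `|B| + 3)).
  by apply: divr_gt0 => //; have := normr_ge0 B; lra.
have B0 := normr_ge0 B.
rewrite !mulrA ltr_pdivrMr; last lra.
by nra.
Qed.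

(** Since [x t^-1 = (x y^-1) (y t^-1)], the displacement is the same for all [t]. *)
Lemma spread_LUC : LUC R G F.
Proof.
split=> [|e e0].
  by apply/bounded_cmod; exists `|B| => x _; exact: spread_bound.
have [d d0 Bd] := small_factor e0.
exists [set n | [/\ W n, W n^-1%g & forall x, `|l (n * x)%g - l x| <= d]].
  apply: filterS (filterI (filterI W1 (nbhs1_inv W1)) (len_near lenl d0)).
  by move=> n [[Wn WVn] nl]; split=> // x; have [] := nl x.
move=> x y [Wn WVn nl]; rewrite norm_cmod ltcR; apply: le_lt_trans Bd.
have E t : (x * t^-1 = (x * y^-1) * (y * t^-1))%g by rewrite mulgA mulgVK.
apply: spread_dist => [|t Tt Wx|t Tt Wy|t Tt]; first exact: ltW.
- have -> : (y * t^-1 = (x * y^-1)^-1 * (x * t^-1))%g.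
    by rewrite invgM invgK mulgA mulgVK.
  exact: WU.
- by rewrite E; exact: WU.
- by rewrite E; exact: nl.
Qed.

(** Here [y t^-1 = (x t^-1) (t (x^-1 y) t^-1)]: the displacement is conjugated by [t], and the
    hypothesis makes it small uniformly on [T]. *)
Lemma spread_RUC : (forall N, nbhs 1%g N ->
    nbhs 1%g [set n | forall t, T t -> N (t * n * t^-1)%g]) ->
  RUC R G F.
Proof.
move=> ET; split=> [|e e0].
  by apply/bounded_cmod; exists `|B| => x _; exact: spread_bound.
have [d d0 Bd] := small_factor e0.
exists [set n | forall t, T t ->
    [set m | [/\ W m, W m^-1%g & forall x, `|l (x * m)%g - l x| <= d]] (t * n * t^-1)%g].
  apply: ET.
  apply: filterS (filterI (filterI W1 (nbhs1_inv W1)) (len_near lenl d0)).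
  by move=> n [[Wn WVn] nl]; split=> // x; have [] := nl x.
move=> x y nt; rewrite norm_cmod ltcR; apply: le_lt_trans Bd.
have E t : (y * t^-1 = (x * t^-1) * (t * (x^-1 * y) * t^-1))%g.
  by rewrite !mulgA mulgVK mulgV mul1g.
apply: spread_dist => [|t Tt Wx|t Tt Wy|t Tt]; first exact: ltW.
- by rewrite E; apply: WU => //; have [] := nt t Tt.
- have [Wm WVm _] := nt t Tt.
  have -> : (x * t^-1 = (y * t^-1) * (t * (x^-1 * y) * t^-1)^-1)%g.
    by rewrite E mulgK.
  exact: WU.
- by rewrite distrC E; have [_ _] := nt t Tt; exact.
Qed.

End Spreading.

(** * Approximable interpolation from spread functions *)

Section Approximable.
Variables (R : realType) (G : topologicalGroupType).
Local Notation C := (Cplx R).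

(** Shared by LUC and WAP. The set [W0] confines the supports: it is the whole group for LUC and [V]
    for WAP. *)
Lemma approximable_of_spread (A : set (G -> C)) (U W0 T : set G) :
  nbhs 1%g U -> nbhs 1%g W0 -> right_discrete_wrt U T ->
  (forall (W : set G) (l : G -> R) (f : G -> C) (B : R),
    W `<=` W0 -> nbhs 1%g W -> (forall a b, W a -> W b -> U (a * b)%g) ->
    length_function l -> (forall x, l x < 1 -> W x) ->
    (forall t, T t -> cmod (f t) <= B) -> A (spread U T l f)) ->
  approximable_interpolation_set A T.
Proof.
move=> U1 W01 dT AF.
have ex N : nbhs 1%g N -> exists W (l : G -> R), [/\ W `<=` W0 `&` N, nbhs 1%g W,
    (forall a b, W a -> W b -> U (a * b)%g),
    length_function l & (forall x, l x < 1 -> W x)].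
  move=> N1; have [M M1 MU] := nbhs1_square U1.
  have WN1 : nbhs 1%g (M `&` (W0 `&` N)) by apply: filterI => //; exact: filterI.
  have [l lenl lW] := exists_length_function R WN1.
  exists (M `&` (W0 `&` N)), l; split=> //.
  by move=> a b [Ma _] [Mb _]; exact: MU.
split=> [f /bounded_cmod[B fB]|N N1].
  have [W [l [WW0 W1 WU lenl lW]]] := ex _ (filterT : nbhs 1%g setT).
  exists (spread U T l f); first by apply: (AF W) fB => // x /WW0[].
  move=> t Tt; rewrite (spreadE _ _ dT Tt); last by rewrite mulgV; exact: nbhs_singleton.
  by rewrite mulgV bump1 ?rmorph1 ?mulr1// (len1 lenl); lra.
have [W [l [WW0 W1 WU lenl lW]]] := ex _ N1.
have lc := len_continuous lenl.
exists [set x | l x < 1 / 3], [set x | l x < 2 / 3].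
have op r : 0 < r -> open_nbhs 1%g [set x : G | l x < r].
  move=> r0; split; last by rewrite /= len1.
  by apply: (@open_comp _ _ l [set y | y < r]) => [x _|]; [exact: lc|exact: open_lt].
split=> [| | | |T1 T1T]; [apply: op; lra|apply: op; lra| | |].
- have clos : closed [set x : G | l x <= 1 / 3].
    by apply: (@closed_comp _ _ l [set y | y <= 1 / 3]) => [x _|]; [exact: lc|exact: closed_le].
  apply: (@subset_trans _ [set x : G | l x <= 1 / 3]); last by move=> x /=; lra.
  rewrite [X in _ `<=` X](closure_id _).1//.
  by apply: closureS => x /=; exact: ltW.
- by move=> x /= lx; have [] := WW0 x; [apply: lW; lra|].
(* Spreading the indicator of [T1] gives the required [h]: it is 1 on [V1 T1], and a non-zero value
   places the point in [V2 T1]. *)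
pose f t : C := if `[< T1 t >] then 1 else 0.
exists (spread U T l f).
  apply: (AF W l f 1) => // [x /WW0[]//|t _]; rewrite /f.
  by case: ifP => _; rewrite -?[1]/(1%:C) ?cmod0// cmod_real normr1.
split=> [x [v lv [t T1t <-]]|x nx].
  have E : (v * t * t^-1 = v)%g by rewrite mulgK.
  rewrite (spreadE _ _ dT (T1T _ T1t)) E; last first.
    rewrite -[v]mulg1; apply: WU; last exact: nbhs_singleton.
    by apply: lW; move: lv => /= lv; lra.
  by rewrite bump1 ?rmorph1 ?mulr1 /f ?asboolT//; exact: ltW.
apply: contrapT => /(spread_neq0 lW)[t [Tt ft lt _]]; apply: nx.
exists (x * t^-1)%g => //; exists t; rewrite ?mulgVK//=.
by move: ft; rewrite /f; case: asboolP.
Qed.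

Lemma LUC_approximable (T : set G) : right_uniformly_discrete T ->
  approximable_interpolation_set (LUC R G) T.
Proof.
move=> [U U1 dT]; apply: (approximable_of_spread U1 filterT dT).
by move=> W l f B _ W1 WU lenl lW fB; exact: (spread_LUC dT WU W1 lenl lW fB).
Qed.

Lemma LUC_RUC_inv (f : G -> C) : LUC R G f -> RUC R G (fun x => f x^-1%g).
Proof.
move=> [/bounded_cmod[M fM] uf]; split.
  by apply/bounded_cmod; exists M => x _; exact: fM.
move=> e /uf[N N1 Nf]; exists [set n | N n^-1%g^-1%g].
  exact: (nbhs1_inv (nbhs1_inv N1)).
by move=> s t; rewrite /= invgK => Nst; apply: Nf; rewrite invgK.
Qed.

(** The LUC case for the set of inverses of [T], composed with inversion. *)
Lemma RUC_approximable (T : set G) : left_uniformly_discrete T ->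
  mirror_approximable_interpolation_set (RUC R G) T.
Proof.
move=> [U U1 dT].
have : right_uniformly_discrete [set x | T x^-1%g].
  exists [set x | U x^-1%g]; first exact: nbhs1_inv.
  move=> s t Ts Tt st; apply/seteqP; split=> // x.
  move=> [[a Ua [_ -> ax]] [b Ub [_ -> bx]]].
  have : (setmulg [set s^-1%g] U `&` setmulg [set t^-1%g] U) x^-1%g.
    split; [exists s^-1%g => //; exists a^-1%g => //|exists t^-1%g => //; exists b^-1%g => //].
      by rewrite -ax invgM.
    by rewrite -bx invgM.
  by rewrite dT// => /invg_inj.
move=> /LUC_approximable[interp app]; split=> [f bf|N N1].
  have [|g Lg gf] := interp (fun x => f x^-1%g).
    move/bounded_cmod : bf => [M fM]; apply/bounded_cmod.
    by exists M => t Tt; exact: fM.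
  exists (fun x => g x^-1%g); first exact: LUC_RUC_inv.
  by move=> t Tt; rewrite gf /= invgK.
have [V1 [V2 [[oV1 V11] [oV2 V21] clV V2N h]]] := app _ (nbhs1_inv N1).
have op V : open V -> open [set x : G | V x^-1%g].
  by move=> oV; apply: (@open_comp _ _ (fun x : G => x^-1%g)) => // x _; exact: invg_continuous.
exists [set x | V1 x^-1%g], [set x | V2 x^-1%g]; split.
- by split; [exact: op|rewrite /= invg1].
- by split; [exact: op|rewrite /= invg1].
- move=> x cx; apply: clV => N' /(@invg_continuous G x)/cx[y [Vy Ny]].
  by exists y^-1%g.
- by move=> x /V2N /=; rewrite invgK.
move=> T1 T1T; have [|g Lg [g1 g0]] := h [set x | T1 x^-1%g]; first by move=> x /T1T.
exists (fun x => g x^-1%g); first exact: LUC_RUC_inv.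
split=> [x [t T1t [v Vv <-]]|x nx].
  by apply: g1; exists v^-1%g => //; exists t^-1%g; rewrite /= ?invgK// invgM.
apply: g0 => -[v Vv [t T1t vt]]; apply: nx; exists t^-1%g => //; exists v^-1%g.
  by rewrite /= invgK.
by rewrite -invgM vt invgK.
Qed.

End Approximable.

(** * Weak convergence in the space of bounded continuous functions *)

Section PrimeFilters.

(** The ultrafilter property in a form that passes to images at once; properness is assumed
    separately. *)
Definition prime_filter (I : Type) (F : set_system I) : Prop :=
  forall A : set I, F A \/ F (~` A).

Lemma prime_fmap (I J : Type) (F : set_system I) (h : I -> J) :
  prime_filter F -> prime_filter (h @ F).
Proof. by move=> pF A; exact: (pF (h @^-1` A)). Qed.

Lemma prime_cvg (I : Type) (X : topologicalType) (F : set_system I) (h : I -> X)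
    (K : set X) : ProperFilter F -> prime_filter F -> compact K ->
  F (h @^-1` K) -> exists2 p, K p & h @ F --> p.
Proof.
move=> PF pF cK FK; have [p [Kp clp]] := cK _ (fmap_proper_filter h PF) FK.
exists p => // N Np; have [//|FcN] := prime_fmap h pF N.
by have [y [ncN Ny]] := clp _ _ FcN Np.
Qed.

(** An ultrafilter on the closure of [A] is replaced by one on [A] containing the traces of its open
    members. The limit [p] of the latter is a limit of the former: by regularity, missing a closed
    neighbourhood of [p] would put its open complement in both. *)
Lemma precompact_of_prime_cvg (X : topologicalType) (A : set X) :
  regular_space X ->
  (forall F : set_system X, ProperFilter F -> prime_filter F -> F A ->
    exists p : X, F --> p) ->
  precompact A.
Proof.
move=> regX cvA; rewrite precompactE compact_ultra => F UF FclA.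
pose trace := filter_from [set O | open O /\ F O] (fun O => O `&` A).
have Ptrace : ProperFilter trace.
  apply: filter_from_proper; last first.
    move=> O [oO FO]; have [x [clAx Ox]] := filter_ex (filterI FclA FO).
    have [y [Ay Oy]] := clAx O (open_nbhs_nbhs (conj oO Ox)).
    by exists y.
  apply: filter_from_filter; first by exists setT; split; [exact: openT|exact: filterT].
  move=> O1 O2 [oO1 FO1] [oO2 FO2]; exists (O1 `&` O2).
    by split; [exact: openI|exact: filterI].
  by move=> x [[]].
have [H [UH traceH]] := ultraFilterLemma Ptrace.
have HA : H A.
  by apply: traceH; exists setT; [split; [exact: openT|exact: filterT]|move=> x []].
have [p Hp] := cvA H _ (fun B => in_ultra_setVsetC B UH) HA.
exists p; split=> [N Np|N /regX[M Mp clMN]].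
  exact: filter_ex (filterI HA (Hp N Np)).
have [FclM|FnclM] := in_ultra_setVsetC (closure M) UF; first exact: filterS FclM.
have HnM : H (~` closure M `&` A).
  by apply: traceH; exists (~` closure M) => //; split=> //; rewrite openC; exact: closed_closure.
have [y [[nclMy _] My]] := filter_ex (filterI HnM (Hp M Mp)).
by case: nclMy; exact: subset_closure.
Qed.

Lemma prime_cvg_cmod (R : realType) (I : Type) (F : set_system I)
    (h : I -> Cplx R) (M : R) :
  ProperFilter F -> prime_filter F -> (forall i, cmod (h i) <= M) ->
  exists z : Cplx R, forall e : R, 0 < e -> F [set i | cmod (h i - z) < e].
Proof.
move=> PF pF hM.
have cvR (u : I -> R) : (forall i, `|u i| <= M) ->
    exists r : R, forall e : R, 0 < e -> F [set i | `|u i - r| < e].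
  move=> uM; have [|r _ /cvgrPdist_lt ur] :=
    @prime_cvg I R F u `[- M, M]%classic PF pF (@segment_compact _ _ _).
    by apply: filterS filterT => i _; rewrite /= in_itv/= -ler_norml.
  by exists r => e /ur; apply: filterS => i; rewrite /= distrC.
have [|a Ha] := cvR (fun i => complex.Re (h i)).
  move=> i; apply: le_trans (hM i); rewrite -lecR.
  exact: normc_ge_Re.
have [|b Hb] := cvR (fun i => complex.Im (h i)).
  move=> i; apply: le_trans (hM i); rewrite -lecR -[(cmod _)%:C]/(`|h i|) normc_def lecR.
  by rewrite -sqrtr_sqr ler_sqrt ?addr_ge0 ?sqr_ge0// lerDr sqr_ge0.
exists (a +i* b) => e e0.
have e20 : 0 < e / 2 by lra.
apply: filterS (filterI (Ha _ e20) (Hb _ e20)) => i /= [ia ib].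
have -> : h i - (a +i* b) =
    (complex.Re (h i) - a)%:C + (0 +i* 1) * (complex.Im (h i) - b)%:C :> R[i].
  by case: (h i) => x y; apply/eqP; rewrite eq_complex /=; apply/andP; split; apply/eqP; ring.
apply: le_lt_trans (cmodD _ _) _; rewrite cmodM !cmod_real.
have -> : cmod (0 +i* 1 : Cplx R) = 1.
  by rewrite /cmod normc_def /= expr0n add0r expr1n sqrtr1.
lra.
Qed.

End PrimeFilters.

Section WeakExtraction.
Variables (R : realType) (Y : topologicalType).
Local Notation C := (Cplx R).
Local Notation E := (bcfun R Y).
Implicit Types (phi : dual E) (v : E).

Lemma bcfunDE v w x : (v + w) x = v x + w x. Proof. by []. Qed.
Lemma bcfunBE v w x : (v - w) x = v x - w x. Proof. by []. Qed.
Lemma bcfunZE (a : C) v x : (a *: v) x = a * v x. Proof. by []. Qed.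

Lemma bcfun_bounded v : exists M, forall x, cmod (v x) <= M.
Proof.
have /bcontP[_ [M vM]] := valP v; exists (complex.Re M) => x.
by have := vM x; rewrite norm_cmod lecE => /andP[].
Qed.

Lemma dual_small phi (e : R) : 0 < e -> exists2 r : R, 0 < r &
  forall v, (forall x, cmod (v x) <= r) -> cmod (sval phi v) < e.
Proof.
move=> e0; case: phi => phi cphi /=.
have /cvgrPdist_lt/(_ e%:C) := cphi 0.
have e0' : 0 < e%:C :> C by rewrite ltcR.
move=> /(_ e0'); rewrite linear0 => /nbhs_norm0P[r /= r0 Hr].
have rE : r = (complex.Re r)%:C :> C by rewrite RRe_real//; exact: gtr0_real.
have Rr0 : 0 < complex.Re r by move: r0; rewrite rE ltcR.
exists (complex.Re r / 2) => [|v vr]; first lra.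
have vr' : `|v| < r.
  apply: (@le_lt_trans _ _ (complex.Re r / 2)%:C).
    apply: sup_norm_le => [|x]; first by rewrite lecR; lra.
    by rewrite norm_cmod lecR.
  by rewrite [ltRHS]rE ltcR; lra.
by have := Hr v vr'; rewrite /= sub0r normrN norm_cmod ltcR.
Qed.

(* The threshold [d] is independent of [h]: in the application the sequence [h]
   is constructed in terms of [d]. *)
Lemma weak_extraction phi (e M : R) : 0 < e -> 0 <= M ->
  exists2 d : R, 0 < d & forall h : nat -> E,
    (forall n x, cmod (h n x) <= M) -> (forall n, e <= cmod (sval phi (h n))) ->
    exists2 s : nat -> nat, {homo s : i j / (i < j)%N} &
      forall k, exists x, forall i, (i < k)%N -> d <= cmod (h (s i) x).
Proof.
move=> e0 M0; have [r r0 phir] := dual_small phi e0.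
exists (r / 2) => [|h hM hphi]; first lra.
apply: contrapT => nos.
pose En n := [set x | r / 2 <= cmod (h n x)].
(* Here [v] stands for a convex combination of unimodular multiples of the [h n], and [u] for the
   same combination of the indicators of the [En n]; off [En n], [h n] is below [r / 2]. *)
pose D k := [set u : Y -> R | [/\ forall x, 0 <= u x <= 1,
  exists N, forall x, u x != 0 -> exists2 n, (k <= n < N)%N & En n x &
  exists2 v : E, forall x, cmod (v x) <= r / 2 + M * u x & e <= complex.Re (sval phi v)]].
have cD : convex_chain En D.
  split=> [k|k u [u01 [N HN] uv]|k u v a a01 [u01 [N HN] [f fu fe]] [v01 [N' HN'] [g gv ge]]
          |k u x []//|k u []//].
  (* The unimodular factor [c] turns the value of [phi] at [h k] into its modulus, so that the real
     parts add up under convex combinations. *)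
  - pose z := sval phi (h k); pose c : C := `|z| / z.
    have z0 : cmod z != 0 by rewrite gt_eqF//; apply: lt_le_trans e0 (hphi k).
    have cz : c * z = `|z|.
      by rewrite /c divfK//; apply: contra_neq z0 => ->; exact: cmod0.
    have c1 : cmod c = 1.
      apply: (mulIf z0); rewrite -cmodM cz norm_cmod cmod_real mul1r.
      by rewrite ger0_norm//; exact: cmod_ge0.
    exists (\1_(En k)); split=> [x||].
    + by rewrite indicE; case: (_ \in _); rewrite /= ?lexx ?ler01.
    + exists k.+1 => x; rewrite indicE pnatr_eq0 eqb0 negbK => /set_mem Ex.
      by exists k; rewrite // leqnn ltnSn.
    + exists (c *: h k) => [x|].
        have -> : cmod ((c *: h k) x) = cmod (h k x).
          by rewrite bcfunZE cmodM c1 mul1r.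
        rewrite indicE; have := hM k x; have := cmod_ge0 (h k x).
        case: (boolP (x \in En k)) => [/set_mem Ex|]; first by rewrite mulr1; lra.
        by rewrite notin_setE /En /= => /negP; rewrite -ltNge mulr0; lra.
      rewrite linearZ /=; apply: le_trans (hphi k) _.
      by rewrite -[c *: _]/(c * z) cz.
  - split=> //; exists N => x /HN[n /andP[kn nN] ?]; exists n => //; lia.
  - have /andP[a0 a1] := a01; split.
    + by move=> x; have /andP[? ?] := u01 x; have /andP[? ?] := v01 x; apply/andP; split; nra.
    + exists (maxn N N') => x.
      have [ux0|/HN[n nN En0] _] := eqVneq (u x) 0; last by exists n => //; lia.
      have [vx0|/HN'[n nN En0] _] := eqVneq (v x) 0; last by exists n => //; lia.
      by rewrite ux0 vx0 !mulr0 addr0 eqxx.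
    + exists (a%:C *: f + (1 - a)%:C *: g) => [x|].
        rewrite bcfunDE !bcfunZE; apply: le_trans (cmodD _ _) _.
        rewrite !cmodM !cmod_real !ger0_norm ?subr_ge0//.
        by have := fu x; have := gv x; nra.
      rewrite linearD !linearZ /=; move: fe ge.
      case: (sval phi f) (sval phi g) => [x y] [x' y'] /= xe xe'.
      by rewrite !mul0r !subr0; nra.
(* For such a [u], [v] is at most [r / 2 + r / 2], which makes [phi v] smaller than [e]. The [+ 1]
   covers [M = 0]. *)
have [||u [_ _ [v vu ve]] us] := @chain_uniformly_small R Y En D (r / (2 * (M + 1))) cD.
- move=> s smono; apply: contrapT => H; apply: nos; exists s => // k.
  apply: contrapT => H'; apply: H; exists k; apply/seteqP; split=> // x Ex.
  by apply: H'; exists x => i ik; exact: Ex.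
- by rewrite divr_gt0//; lra.
have : cmod (sval phi v) < e.
  apply: phir => x; apply: le_trans (vu x) _.
  have := us x; rewrite ltr_pdivlMr; last lra.
  by have [->|] := eqVneq M 0; nra.
apply/negP; rewrite -leNgt; apply: le_trans ve _.
by apply: le_trans (ler_norm _) _; rewrite -lecR; exact: normc_ge_Re.
Qed.

End WeakExtraction.

(** * Weak limits of translates *)

Section Precompact.
Variable G : topologicalGroupType.

Lemma setmulg1l (b : G) (S : set G) x : setmulg [set b^-1%g] S x <-> S (b * x)%g.
Proof.
split=> [[_ -> [y Sy <-]]|Sbx]; first by rewrite mulVKg.
by exists b^-1%g => //; exists (b * x)%g; rewrite ?mulKg.
Qed.

Lemma setmulg1r (b : G) (S : set G) x : setmulg S [set b^-1%g] x <-> S (x * b)%g.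
Proof.
split=> [[y Sy [_ -> <-]]|Sxb]; first by rewrite mulgVK.
by exists (x * b)%g => //; exists b^-1%g; rewrite ?mulgK.
Qed.

Lemma precompact_translate (a : G) (A : set G) :
  precompact A -> precompact [set x | A (a^-1 * x)%g].
Proof.
move=> [K AK [cK clK]]; exists [set x | K (a^-1 * x)%g]; first by move=> x /AK.
split; last first.
  by apply: (@closed_comp _ _ (fun x => a^-1 * x)%g) => // x _; exact: continuous_Ml.
have -> : [set x | K (a^-1 * x)%g] = [set (a * x)%g | x in K].
  apply/seteqP; split=> [x Kx|_ [x Kx <-]]; last by rewrite /= mulKg.
  by exists (a^-1 * x)%g; rewrite ?mulVKg.
apply: continuous_compact cK; apply: continuous_subspaceT; exact: continuous_Ml.
Qed.

(** Two terms close to a cluster point [p] would satisfy [(s i)^-1 (s j) = (p^-1 s i)^-1 (p^-1 s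
    j)], an element of [W]. *)
Lemma separated_not_precompact (W : set G) (s : nat -> G) : nbhs 1%g W ->
  (forall i j, (i < j)%N -> ~ W ((s i)^-1 * s j)%g) -> ~ precompact (range s).
Proof.
move=> W1 sepW [K sK [cK _]].
have [p [_ clp]] := cK (s @ \oo) _ (filterS (fun n _ => sK _ (imageT s n)) filterT).
have [N N1 NW] := nbhs1_square W1.
have Bp : nbhs p [set y | (N `&` [set x | N x^-1%g]) (p^-1 * y)%g].
  by apply: nbhs1_divl; apply: filterI => //; exact: nbhs1_inv.
have [_ [[i _ <-] [_ Ni]]] := clp (range s) _
  (filterS (fun n _ => imageT s n) filterT : (s @ \oo) (range s)) Bp.
have [|_ [[j ij <-] [Nj _]]] := clp [set s j | j in [set j | (i < j)%N]] _ _ Bp.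
  by apply: filterS (nbhs_infty_gt i) => j ij; exists j.
apply: (sepW i j ij); have := NW _ _ Ni Nj.
by rewrite invgM invgK !mulgA mulgK.
Qed.

End Precompact.

Section WeakLimits.
Variables (R : realType) (G : topologicalGroupType).
Local Notation C := (Cplx R).

Lemma uniform_continuous (g : G -> C) :
  (forall e : R, 0 < e -> exists2 N : set G, nbhs 1%g N &
    forall x y, N (x^-1 * y)%g -> cmod (g x - g y) < e) -> continuous g.
Proof.
move=> ug x; apply/cvgrPdist_lt => e e0.
have eE : e = (complex.Re e)%:C :> C by rewrite RRe_real//; exact: gtr0_real.
have Re0 : 0 < complex.Re e by move: e0; rewrite eE ltcR.
have [N N1 gN] := ug _ Re0.
by apply: filterS (nbhs1_divl x N1) => y /gN; rewrite eE norm_cmod ltcR.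
Qed.

Lemma exists_bcfun (g : G -> C) (M : R) : continuous g ->
  (forall x, cmod (g x) <= M) -> exists v : bcfun R G, bcfun_val v = g.
Proof.
move=> cg gM; have gP : g \in @bcont R G.
  by apply/bcontP; split=> //; exists M%:C => x; rewrite norm_cmod lecR.
by exists (BCFun gP).
Qed.

Variables (f : G -> C) (S W : set G).
Hypothesis fL : LUC R G f.
Hypothesis fR : RUC R G f.
Hypothesis fS : forall x, f x <> 0 -> S x.
Hypothesis tcS : translation_compact S.
Hypothesis W1 : nbhs 1%g W.
Hypothesis pcW : precompact W.

Lemma LUC_dist (e : R) : 0 < e -> exists2 N : set G, nbhs 1%g N &
  forall x y, N (x * y^-1)%g -> cmod (f x - f y) < e.
Proof.
move=> /fL.2[N N1 fN]; exists N => // x y /fN.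
by rewrite norm_cmod ltcR.
Qed.

Lemma RUC_dist (e : R) : 0 < e -> exists2 N : set G, nbhs 1%g N &
  forall x y, N (x^-1 * y)%g -> cmod (f x - f y) < e.
Proof.
move=> /fR.2[N N1 fN]; exists N => // x y /fN.
by rewrite norm_cmod ltcR.
Qed.

(** As [(s x)^-1 (s y) = x^-1 y], the left translates are equicontinuous; their pointwise limits are
    therefore continuous. *)
Lemma RUC_translate_dist (e : R) : 0 < e -> exists2 N : set G, nbhs 1%g N &
  forall s x y, N (x^-1 * y)%g -> cmod (f (s * x)%g - f (s * y)%g) < e.
Proof.
move=> /RUC_dist[N N1 fN]; exists N => // s x y Nxy; apply: fN.
by rewrite invgM -mulgA mulKg.
Qed.

Lemma translate_bcfun : {tr : G -> bcfun R G | forall s x, tr s x = f (s * x)%g}.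
Proof.
apply: cid; have [M fM] := (bounded_cmod f setT).1 fL.1.
have ex s : exists v : bcfun R G, bcfun_val v = fun x => f (s * x)%g.
  apply: (@exists_bcfun _ M) => [|x]; last exact: fM.
  by apply: uniform_continuous => e /RUC_translate_dist[N N1 fN]; exists N => // x y /fN.
have [tr Htr] := choice ex.
by exists tr => s x; rewrite Htr.
Qed.

Let tr := sval translate_bcfun.
Let trE s x : tr s x = f (s * x)%g := svalP translate_bcfun s x.

Section Along.
Variable F : set_system G.
Hypotheses (PF : ProperFilter F) (pF : prime_filter F).

Lemma pointwise_limit : exists g : bcfun R G, forall x (e : R), 0 < e ->
  F [set s | cmod (f (s * x)%g - g x) < e].
Proof.
have [M fM] := (bounded_cmod f setT).1 fL.1.
have ex x : exists z : C, forall e : R, 0 < e -> F [set s | cmod (f (s * x)%g - z) < e].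
  by apply: (prime_cvg_cmod (M := M)) => // s; exact: fM.
have [g gl] := choice ex.
have gM x : cmod (g x) <= M.
  apply/ler_addgt0Pr => e e0; have [s /= fg] := filter_ex (gl x e e0).
  have -> : g x = f (s * x)%g - (f (s * x)%g - g x) by rewrite opprB addrC subrK.
  by apply: le_trans (cmodD _ _) _; rewrite cmodN lerD ?fM// ltW.
have cg : continuous g.
  apply: uniform_continuous => e e0.
  have e30 : 0 < e / 3 by lra.
  have [N N1 fN] := RUC_translate_dist e30; exists N => // x y Nxy.
  have [s /= [sx sy]] := filter_ex (filterI (gl x _ e30) (gl y _ e30)).
  apply: le_lt_trans (cmod_triangle (f (s * x)%g) _ _) _.
  have := cmod_triangle (f (s * y)%g) (f (s * x)%g) (g y).
  by have := fN s x y Nxy; rewrite [cmod (g x - _)]cmod_distC; lra.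
by have [v vg] := exists_bcfun cg gM; exists v => x; rewrite vg; exact: gl.
Qed.

Variable g : bcfun R G.
Hypothesis gl : forall x (e : R), 0 < e -> F [set s | cmod (f (s * x)%g - g x) < e].

(** The limit [g] inherits the equicontinuity of the translates, so pointwise convergence is locally
    uniform, and compactness makes it uniform. *)
Lemma limit_unif_precompact (K : set G) (e : R) : precompact K -> 0 < e ->
  F [set s | forall x, K x -> cmod (f (s * x)%g - g x) < e].
Proof.
move=> [K' KK' [/compact_near_coveringP cK' _]] e0.
have e30 : 0 < e / 3 by lra.
have cov x : K' x -> \forall y \near x & s \near F, cmod (f (s * y)%g - g y) < e.
  move=> _.
  have [N N1 fN] := RUC_translate_dist e30.
  exists ([set y | N (x^-1 * y)%g], [set s | cmod (f (s * x)%g - g x) < e / 3]).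
    by split; [exact: nbhs1_divl|exact: gl].
  move=> [y s] /= [Nxy sx].
  have gxy : cmod (g x - g y) <= e / 3.
    apply/ler_addgt0Pr => d d0; have d20 : 0 < d / 2 by lra.
    have [t /= [tx ty]] := filter_ex (filterI (gl x d20) (gl y d20)).
    apply: le_trans (cmod_triangle (f (t * x)%g) _ _) _.
    have := cmod_triangle (f (t * y)%g) (f (t * x)%g) (g y).
    by have := fN t x y Nxy; rewrite [cmod (g x - _)]cmod_distC; lra.
  apply: le_lt_trans (cmod_triangle (f (s * x)%g) _ _) _.
  have := cmod_triangle (g x) (f (s * x)%g) (g y).
  by have := fN s x y Nxy; rewrite [cmod (f (s * y)%g - _)]cmod_distC; lra.
have := cK' G F (fun s x => cmod (f (s * x)%g - g x) < e) (@filter_filter _ _ PF) cov.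
by apply: filterS => s sK x /KK'; exact: sK.
Qed.

(** The parameter [s] converges to some [p], and [(s x) (p x)^-1 = s p^-1] does not involve [x]: LUC
    gives uniform convergence. *)
Lemma weak_limit_precompact (K : set G) : precompact K -> F K ->
  exists w : bcfun R G, forall (phi : dual (bcfun R G)) (e : R), 0 < e ->
    F [set s | cmod (sval phi (tr s - w)) < e].
Proof.
move=> [K' KK' [cK' _]] FK.
have [p _ Fp] := @prime_cvg G G F id K' PF pF cK' (filterS KK' FK).
exists (tr p) => phi e /(dual_small phi)[r r0 phir].
have [N N1 fN] := LUC_dist r0.
have FN : F [set s | N (s * p^-1)%g] := Fp _ (nbhs1_divr p N1).
apply: filterS FN => s /= Nsp; apply: phir => x.
rewrite bcfunBE !trE; apply/ltW/fN.
by rewrite invgM mulgA mulgK.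
Qed.

Hypothesis noK : forall K, precompact K -> ~ F K.

(** If [g b <> 0], then [s b] lies in [S] for [F]-most [s]. Left translation compactness, applied to
    the support of [g], would thus put a precompact intersection of sets [S b^-1] in [F]. *)
Lemma limit_support_precompact : precompact [set x | g x <> 0].
Proof.
apply: contrapT => /tcS.2[A [/finite_fsetP[B ->] BL /noK]]; apply.
apply: filter_bigI => b Bb.
have gb : 0 < cmod (g b).
  rewrite lt_neqAle cmod_ge0 andbT eq_sym; apply/eqP => /cmod_eq0; exact: BL.
apply: filterS (gl b gb) => s /= sb; apply/setmulg1r/fS => f0.
by move: sb; rewrite f0 sub0r cmodN ltxx.
Qed.

Local Open Scope fset_scope.

(* The points are chosen one after the other along [F], which is possible since
   each step involves only finitely many precompact intersections. *)
Lemma separated_sequence (A : set G) (d : R) : F A -> 0 < d ->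
  exists2 s : nat -> G, (forall n, A (s n)) &
   [/\ forall i j, (i < j)%N -> ~ W ((s i)^-1 * s j)%g,
       forall n x, g x <> 0 -> cmod (f (s n * x)%g - g x) < d &
       forall n (B : {fset G}), (forall b, b \in B -> exists2 i, (i < n)%N & b = s i) ->
         precompact (\bigcap_(b in [set` B]) setmulg [set b^-1%g] S) ->
         forall x, (\bigcap_(b in [set` B]) setmulg [set b^-1%g] S) x ->
         cmod (f (s n * x)%g - g x) < d].
Proof.
move=> FA d0.
pose K (B : {fset G}) := \bigcap_(b in [set` B]) setmulg [set b^-1%g] S.
have ex (P : {fset G}) : exists s, [/\ A s,
    forall b, b \in P -> ~ W (b^-1 * s)%g,
    forall x, g x <> 0 -> cmod (f (s * x)%g - g x) < d &
    forall B, B `<=` P -> precompact (K B) ->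
      forall x, K B x -> cmod (f (s * x)%g - g x) < d].
  (* The excluded [s] form the translate [b W], a precompact set, which cannot belong to [F]. *)
  have FW : F (\bigcap_(b in [set` P]) [set s | ~ W (b^-1 * s)%g]).
    apply: filter_bigI => b _.
    have [FbW|] := pF [set s | W (b^-1 * s)%g]; last exact.
    by case: (noK (precompact_translate b pcW) FbW).
  (* The set that translation compactness will single out is not known yet, so all subsets of [P]
     are handled at once. *)
  have FK : F (\bigcap_(B in [set` fpowerset P]) [set s | precompact (K B) ->
      forall x, K B x -> cmod (f (s * x)%g - g x) < d]).
    apply: filter_bigI => B _; have [pcK|npcK] := pselect (precompact (K B)).
      by apply: filterS (limit_unif_precompact pcK d0) => s sK _; exact: sK.
    by apply: filterE => s /npcK.
  have [s [[[As sW] sg] sK]] := filter_ex (filterI (filterI (filterI FA FW)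
    (limit_unif_precompact limit_support_precompact d0)) FK).
  exists s; split=> // B BP; apply: sK.
  by rewrite /= fpowersetE.
have [c Hc] := choice ex.
pose P n := iter n (fun P => c P |` P) fset0.
have PP i n : (i < n)%N -> c (P i) \in P n.
  elim: n => // n IH; rewrite ltnS leq_eqVlt /= => /predU1P[->|/IH].
    by rewrite fset1U1.
  exact: fset1Ur.
exists (c \o P) => [n|]; first by have [] := Hc (P n).
split=> [i j ij|n x|n B BP].
- by have [_ + _ _] := Hc (P j); apply; exact: PP.
- by have [_ _ + _] := Hc (P n); exact.
have [_ _ _ +] := Hc (P n); apply.
by apply/fsubsetP => b /BP[i ni ->]; exact: PP.
Qed.

Local Close Scope fset_scope.

Lemma weak_limit_escaping (phi : dual (bcfun R G)) (e : R) : 0 < e ->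
  F [set s | cmod (sval phi (tr s - g)) < e].
Proof.
move=> e0; have [//|FA] := pF [set s | cmod (sval phi (tr s - g)) < e].
have [M fM] := (bounded_cmod f setT).1 fL.1.
have [M' gM'] := bcfun_bounded g.
have M0 : 0 <= `|M| + `|M'| by rewrite addr_ge0.
have [d d0 Hd] := weak_extraction phi e0 M0.
have [s sA [sW sg sK]] := separated_sequence FA d0.
have [n x|n|t tmono tx] := Hd (fun n => tr (s n) - g).
- rewrite bcfunBE trE; apply: le_trans (cmodD _ _) _; rewrite cmodN lerD//.
    by apply: le_trans (ler_norm _); exact: fM.
  exact: le_trans (ler_norm _).
- by rewrite leNgt; apply/negP; exact: sA.
exfalso; have : ~ precompact (range (s \o t)).
  by apply: (separated_not_precompact W1) => i j ij; exact/sW/tmono.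
move=> /tcS.1[_ [/finite_fsetP[B ->] BL pcB]].
have [k Bk] : exists k, forall b, b \in B -> exists2 i, (i < k)%N & b = s (t i).
  have : \forall k \near \oo, (\bigcap_(b in [set` B])
      [set k | exists2 i, (i < k)%N & b = s (t i)]) k.
    apply: filter_bigI => b /BL[i _ <-].
    by apply: filterS (nbhs_infty_gt i) => k ik; exists i.
  by move=> /filter_ex[k Hk]; exists k => b bB; exact: Hk.
(* Rank [k.+1] includes the index [k], which comes after all points of [B]. The indices below [k]
   put [x] in the precompact intersection, where the difference at [k] must be below [d]. *)
have [x Hx] := tx k.+1.
have g0 : g x = 0.
  apply: contrapT => /(sg (t k)); apply/negP; rewrite -leNgt.
  by have := Hx k (ltnSn k); rewrite bcfunBE trE.
have := Hx k (ltnSn k); rewrite bcfunBE trE; apply/negP; rewrite -ltNge.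
apply: sK pcB _ _ => b.
  by move=> /Bk[i ik ->]; exists (t i) => //; exact: tmono.
move=> /Bk[i ik ->]; apply/setmulg1l/fS => f0.
have := Hx i (leqW ik); rewrite bcfunBE trE f0 g0 subr0 cmod0.
by apply/negP; rewrite -ltNge.
Qed.

End Along.

Lemma weak_limit (F : set_system G) : ProperFilter F -> prime_filter F ->
  exists w : bcfun R G, forall (phi : dual (bcfun R G)) (e : R), 0 < e ->
    F [set s | cmod (sval phi (tr s - w)) < e].
Proof.
move=> PF pF; have [[K pK FK]|noK] := pselect (exists2 K, precompact K & F K).
  exact: weak_limit_precompact pK FK.
have [g gl] := pointwise_limit PF pF.
exists g => phi e; apply: weak_limit_escaping => // K pK FK; apply: noK.
by exists K.
Qed.

Lemma translates_weakly_compact : relatively_weakly_compact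
  [set h : bcfun R G | left_translates f (bcfun_val h)].
Proof.
apply: precompact_of_prime_cvg; first exact: uniform_regular.
move=> F PF pF FA.
(* Choosing a parameter for each translate carries the filter over to [G]; functions that are not
   translates get the dummy parameter 1. *)
have ex (h : bcfun R G) : exists s, left_translates f (bcfun_val h) -> h = tr s.
  have [[s hs]|nh] := pselect (left_translates f (bcfun_val h)); last by exists 1%g.
  by exists s => _; apply/val_inj/funext => x /=; rewrite hs -trE.
have [sg Hsg] := choice ex.
have [w Hw] := weak_limit (fmap_proper_filter sg PF) (prime_fmap sg pF).
exists w => N [_ [[B oB <-] Bw BN]]; apply: filterS BN _.
have cv : @dual_eval C (bcfun R G) @ F --> @dual_eval C (bcfun R G) w.
  apply/cvg_sup => phi N' [_ [[D oD <-] Dw DN']]; apply: filterS DN' _.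
  have /nbhs_normP[e /= e0 eD] : nbhs (sval phi w : C) D.
    exact: open_nbhs_nbhs.
  have eE : e = (complex.Re e)%:C :> C by rewrite RRe_real//; exact: gtr0_real.
  have Re0 : 0 < complex.Re e by move: e0; rewrite eE ltcR.
  have Fsg : F [set h | cmod (sval phi (tr (sg h) - w)) < complex.Re e] := Hw phi _ Re0.
  have sub : [set h | left_translates f (bcfun_val h)] `&`
      [set h | cmod (sval phi (tr (sg h) - w)) < complex.Re e] `<=`
      [set h : bcfun R G | D (sval phi h)].
    move=> h [/Hsg hE]; rewrite /mkset -hE => he; apply: eD.
    by rewrite /= eE distrC norm_cmod ltcR -linearB.
  exact: filterS sub (filterI FA Fsg).
by apply: cv; exact: open_nbhs_nbhs.
Qed.

Lemma WAP_of_support : WAP R G f.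
Proof.
split; [|exact: fL.1|exact: translates_weakly_compact].
by apply: uniform_continuous => e /RUC_dist.
Qed.

End WeakLimits.

(** * E-sets *)

Section ESets.
Variables (R : realType) (G : topologicalGroupType).
Implicit Types S T U V N : set G.

Lemma E_set_conj T N : E_set T -> nbhs 1%g N ->
  nbhs 1%g [set n | forall t, T t -> N (t * n * t^-1)%g].
Proof.
move=> [_ ET] /ET; apply: filterS => n Tn t Tt.
by have [x Nx <-] := Tn t (or_introl Tt); rewrite !mulgA mulgV mul1g mulgK.
Qed.

Lemma E_set_conjV T N : E_set T -> nbhs 1%g N ->
  nbhs 1%g [set n | forall t, T t -> N (t^-1 * n * t)%g].
Proof.
move=> [_ ET] /ET; apply: filterS => n Tn t Tt.
have [|x Nx <-] := Tn t^-1%g; first by right; exists t.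
by rewrite invgK !mulgA mulVg mul1g mulgVK.
Qed.

Lemma translation_compact_subset S S' : S' `<=` S ->
  translation_compact S -> translation_compact S'.
Proof.
move=> S'S [rS lS]; split=> L.
  move=> /rS[A [fA AL pA]]; exists A; split=> //; apply: precompact_subset pA.
  by move=> x Sx b Ab; apply/setmulg1l/S'S/setmulg1l; exact: Sx.
move=> /lS[A [fA AL pA]]; exists A; split=> //; apply: precompact_subset pA.
by move=> x Sx b Ab; apply/setmulg1r/S'S/setmulg1r; exact: Sx.
Qed.

(* Otherwise [L := V] would be admissible in the definition of translation
   compactness, but [T] is included in each [b^-1 V T] with [b] in [V]. *)
Lemma translation_compact_nbhs T V : ~ precompact T ->
  translation_compact (setmulg V T) -> precompact V.
Proof.
move=> npT [rVT _]; apply: contrapT => /rVT[A [_ AV pA]]; apply: npT.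
apply: precompact_subset pA => t Tt b Ab; apply/setmulg1l.
by exists b; [exact: AV|exists t].
Qed.

Lemma WAP_approximable T U V : E_set T -> nbhs 1%g U -> nbhs 1%g V ->
  right_discrete_wrt U T -> translation_compact (setmulg V T) ->
  approximable_interpolation_set (WAP R G) T.
Proof.
move=> ET U1 V1 dT tcVT; apply: (approximable_of_spread U1 V1 dT).
move=> W l f B WV W1 WU lenl lW fB.
(* [V] serves twice: [V T] contains the support, and [V] itself is the precompact neighbourhood that
   separates the points of the sequence. *)
apply: (@WAP_of_support _ _ _ (setmulg V T) V) => //.
- exact: (spread_LUC dT WU W1 lenl lW fB).
- by apply: (spread_RUC dT WU W1 lenl lW fB) => N; exact: E_set_conj.
- move=> x /(spread_neq0 lW)[t [Tt _ _ Wx]].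
  by exists (x * t^-1)%g; [exact: WV|exists t; rewrite ?mulgVK].
- exact: translation_compact_nbhs ET.1 tcVT.
Qed.

(** Reduction to the right-handed case: if [t^-1 n t] lies in [U] for all [t] in [T], then
    [n t = t (t^-1 n t)] lies in [t U], and likewise for [V]. *)
Lemma WAP_approximable_left T U V : E_set T -> nbhs 1%g U -> nbhs 1%g V ->
  left_discrete_wrt U T -> translation_compact (setmulg T V) ->
  approximable_interpolation_set (WAP R G) T.
Proof.
move=> ET U1 V1 dT tcTV.
apply: (WAP_approximable ET (E_set_conjV ET U1) (E_set_conjV ET V1)).
  move=> s t Ts Tt st; apply/seteqP; split=> // x.
  move=> [[a Ua [_ -> ax]] [b Ub [_ -> bx]]].
  have <- := dT s t Ts Tt st; split.
    by exists s => //; exists (s^-1 * a * s)%g; rewrite ?mulgA ?mulgV ?mul1g//; exact: Ua.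
  by exists t => //; exists (t^-1 * b * t)%g; rewrite ?mulgA ?mulgV ?mul1g//; exact: Ub.
apply: translation_compact_subset tcTV => _ [v Vv [t Tt <-]].
by exists t => //; exists (t^-1 * v * t)%g; rewrite ?mulgA ?mulgV ?mul1g//; exact: Vv.
Qed.

End ESets.

Theorem lemma4p8 (R : realType) (G : topologicalGroupType) (T : set G) :
  ((right_uniformly_discrete T ->
      approximable_interpolation_set (LUC R G) T) /\
   (left_uniformly_discrete T ->
      mirror_approximable_interpolation_set (RUC R G) T)) /\
  (E_group G -> E_set T ->
   ((forall U V : set G, nbhs 1%g U -> nbhs 1%g V ->
       right_discrete_wrt U T -> setmulg V V `<=` U ->
       translation_compact (setmulg V T) ->
       approximable_interpolation_set (WAP R G) T) /\
    (forall U V : set G, nbhs 1%g U -> nbhs 1%g V ->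
       left_discrete_wrt U T -> setmulg V V `<=` U ->
       translation_compact (setmulg T V) ->
       approximable_interpolation_set (WAP R G) T))).
Proof.
split; first by split; [exact: LUC_approximable|exact: RUC_approximable].
move=> _ ET; split=> U V U1 V1 dT _ tc.
  exact: WAP_approximable ET U1 V1 dT tc.
exact: WAP_approximable_left ET U1 V1 dT tc.
Qed.
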